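(* If $G$ is a finite simple graph with no isolated vertices, then $\Gamma_t(G)\le 2\gamma_{\rm gr}^{\rm Z}(G)$.
   Context: A total dominating set (TD-set) of $G$ is a set $D$ such that every vertex of $G$ has a neighbor in $D$. A TD-set is minimal if no proper subset of it is a TD-set. The upper total domination number $\Gamma_t(G)$ is the maximum cardinality of a minimal TD-set. With $N[v]=N(v)\cup\{v\}$, a sequence $(v_1,\ldots,v_k)$ of distinct vertices is a Z-sequence if for every $i\in\{1,\ldots,k\}$, $N(v_i)\setminus\bigcup_{j<i}N[v_j]\ne\emptyset$; $\gamma_{\rm gr}^{\rm Z}(G)$ is the maximum length of a Z-sequence. *)

(* Defs.v *)
From mathcomp Require Import all_boot.

Set Implicit Arguments.
Unset Strict Implicit.
Unset Printing Implicit Defensive.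

(* A finite simple graph is a symmetric irreflexive adjacency relation [e] on
   a finite vertex type [V]; symmetry and irreflexivity are hypotheses of the
   statements, not part of the definitions below. *)
Section Graph.

Variables (V : finType) (e : rel V).

Definition nbhd (v : V) : {set V} := [set w | e v w].

Definition closed_nbhd (v : V) : {set V} := v |: nbhd v.

Definition no_isolated_vertices : Prop := forall v : V, nbhd v != set0.

Definition total_dominating (D : {set V}) : bool :=
  [forall v : V, [exists w in D, w \in nbhd v]].

Definition minimal_total_dominating (D : {set V}) : bool :=
  total_dominating D &&
  [forall D' : {set V}, (D' \proper D) ==> ~~ total_dominating D'].

(* [\max] is 0 over an empty range; the range is nonempty whenever the graph
   has no isolated vertices. *)
Definition upper_total_domination : nat :=
  \max_(D : {set V} | minimal_total_dominating D) #|D|.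

Definition Z_sequence (k : nat) (s : k.-tuple V) : bool :=
  uniq s &&
  [forall i : 'I_k,
     nbhd (tnth s i) :\: \bigcup_(j < k | j < i) closed_nbhd (tnth s j)
       != set0].

(* A sequence of distinct vertices has length at most #|V|, so bounding [k]
   by #|V| excludes no Z-sequence. *)
Definition Z_grundy_domination : nat :=
  \max_(k < #|V|.+1 | [exists s : k.-tuple V, Z_sequence s]) k.

End Graph.

(* Main.v *)
Require Import Defs.
From mathcomp Require Import all_boot.

(** In a minimal total dominating set [D] every vertex [v] has a private
    neighbor [p v], adjacent to no other vertex of [D]. List some vertices of
    [D] in an order such that [v] precedes [p v] whenever [p v] lies in [D]:
    then [p v] is outside the closed neighborhoods of all earlier vertices, and
    the list is a Z-sequence. Fix a linear order on the vertices; every [v] of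
    [D] satisfies this condition for the order or for its converse, so one of
    the two yields a Z-sequence containing at least half of [D]. *)

Section PrivateNeighbors.

Variables (V : finType) (e : rel V).

Lemma leq_Z_grundy_domination (k : nat) (s : k.-tuple V) :
  Z_sequence e s -> k <= Z_grundy_domination e.
Proof.
move=> sZ; have s_uniq : uniq s by case/andP: sZ.
have lt_k : k < #|V|.+1.
  by rewrite ltnS -(size_tuple s) -(card_uniqP s_uniq) max_card.
apply: (@leq_bigmax_cond _ _ _ (Ordinal lt_k)).
by apply/existsP; exists s.
Qed.

(** By minimality [D :\ v] leaves some [u] without a neighbor in it, while [D] itself gives [u] a
    neighbor; that neighbor can only be [v]. *)
Lemma minimal_total_dominating_private (D : {set V}) :
  minimal_total_dominating e D ->
  {in D, forall v, exists u, forall w, (w \in D) && e u w = (w == v)}.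
Proof.
case/andP=> /forallP domD /forallP minD v vD.
have := implyP (minD (D :\ v)) (properD1 vD).
rewrite negb_forall => /existsP[u /exists_inPn no_nbr]; exists u.
have nbr_v w : w \in D -> e u w -> w = v.
  move=> wD euw; apply: contraTeq euw => neq_wv.
  by have := no_nbr w; rewrite !inE neq_wv wD => /(_ isT).
move=> w; apply/andP/eqP => [[wD euw]|->]; first exact: nbr_v.
split=> //; have /exists_inP[x xD] := domD u; rewrite inE => eux.
by rewrite -(nbr_v x).
Qed.

Hypothesis e_sym : symmetric e.

Lemma card_private_leq_Z_grundy (leT : rel V) (D : {set V}) (p : V -> V) :
    total leT -> transitive leT -> antisymmetric leT ->
    {in D, forall v w, (w \in D) && e (p v) w = (w == v)} ->
  #|[set v in D | (p v \in D) ==> leT v (p v)]| <= Z_grundy_domination e.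
Proof.
move=> leT_total leT_tr leT_anti p_private; set S := [set v in D | _].
pose t := sort leT (enum S).
have t_uniq : uniq t by rewrite sort_uniq enum_uniq.
have t_size : size t == #|S| by rewrite size_sort -cardE.
have mem_t v : (v \in t) = (v \in S) by rewrite mem_sort mem_enum.
have t_sorted : sorted leT t by exact: sort_sorted.
apply: (@leq_Z_grundy_domination _ (Tuple t_size)).
rewrite /Z_sequence /= t_uniq; apply/forallP=> i.
have [vD p_v] : tnth (Tuple t_size) i \in D /\
    ((p (tnth (Tuple t_size) i) \in D) ==>
      leT (tnth (Tuple t_size) i) (p (tnth (Tuple t_size) i))).
  by apply/andP; have := mem_tnth i (Tuple t_size); rewrite mem_t inE.
set v := tnth _ i in vD p_v *.
apply/set0Pn; exists (p v); rewrite !inE.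
have := p_private v vD v; rewrite eqxx e_sym => /andP[_ ->]; rewrite andbT.
apply/bigcupP=> -[j lt_ji].
have : tnth (Tuple t_size) j \in t by exact: mem_tnth.
rewrite mem_t inE => /andP[wD _].
have neq_wv : tnth (Tuple t_size) j != v.
  rewrite /v !(tnth_nth v) /= nth_uniq ?(eqP t_size) //.
  by rewrite neq_ltn lt_ji.
(* Transitivity turns sortedness of adjacent entries into a comparison of any two positions
   [j < i]. *)
have le_wv : leT (tnth (Tuple t_size) j) v.
  have := t_sorted; rewrite (sorted_pairwise leT_tr) => /(pairwiseP v) t_pw.
  by rewrite /v !(tnth_nth v) /= t_pw // inE (eqP t_size).
(* If [p v] were the earlier entry itself, that entry and [v] would each precede the other, against
   antisymmetry; if it were adjacent to that entry, [p v] would not be private to [v]. *)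
rewrite !inE => /orP[/eqP p_eq | ewp].
  move: p_v; rewrite p_eq wD /= => le_vw.
  by case/eqP: neq_wv; apply: leT_anti; rewrite le_wv.
have := p_private v vD (tnth (Tuple t_size) j).
by rewrite wD e_sym ewp (negPf neq_wv).
Qed.

Lemma minimal_total_dominating_leq_Z_grundy (D : {set V}) :
  minimal_total_dominating e D -> #|D| <= 2 * Z_grundy_domination e.
Proof.
move=> /minimal_total_dominating_private priv.
(* Choice needs a total function, so outside [D] an arbitrary value, here [v] itself, is allowed. *)
have /fin_all_exists[p p_priv] v :
    exists u, v \in D -> forall w, (w \in D) && e u w = (w == v).
  have [/priv[u Hu]|_] := boolP (v \in D); first by exists u.
  by exists v.
pose le1 : rel V := relpre enum_rank (fun i j : 'I_#|V| => i <= j).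
pose le2 : rel V := fun x y => le1 y x.
pose S (leT : rel V) := [set v in D | (p v \in D) ==> leT v (p v)].
have le1_total : total le1 by move=> x y; exact: leq_total.
have le1_tr : transitive le1 by move=> y x z; exact: leq_trans.
have le1_anti : antisymmetric le1.
  by move=> x y /anti_leq/val_inj/enum_rank_inj.
have S1_le : #|S le1| <= Z_grundy_domination e.
  exact: card_private_leq_Z_grundy.
have S2_le : #|S le2| <= Z_grundy_domination e.
  apply: card_private_leq_Z_grundy => //.
  - by move=> x y; exact: le1_total.
  - by move=> y x z le_yx le_zy; exact: le1_tr le_zy le_yx.
  - by move=> x y; rewrite andbC; exact: le1_anti.
(* When [p v] lies in [D], totality of [le1] puts [v] in one of the two sets; otherwise both
   conditions hold vacuously. *)
have D_sub : D \subset S le1 :|: S le2.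
  apply/subsetP=> v vD; rewrite !inE vD /=.
  by case: (p v \in D) => //=; exact: le1_total.
rewrite mul2n -addnn; apply: leq_trans (subset_leq_card D_sub) _.
by apply: leq_trans (leq_card_setU _ _) _; exact: leq_add.
Qed.

End PrivateNeighbors.

Theorem theorem4p2 (V : finType) (e : rel V)
    (e_sym : symmetric e) (e_irr : irreflexive e)
    (e_noiso : no_isolated_vertices e) :
  upper_total_domination e <= 2 * Z_grundy_domination e.
Proof.
by apply/bigmax_leqP=> D; exact: minimal_total_dominating_leq_Z_grundy.
Qed.
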